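(* For a finite bipartite graph $G$ the following are equivalent: (i) $G$ is an interval containment bigraph; (ii) $G$ is a chordal bigraph and a cocomparability bigraph; (iii) $G$ has no induced cycle of length $6$ and is a cocomparability bigraph.
   Context: Let $(X,Y)$ be a bipartition of $G$. $G$ is an interval containment bigraph if there are intervals $I_v$ ($v\in X\cup Y$) of the real line such that for $x\in X$, $y\in Y$, $xy\in E(G)$ iff $I_x\supseteq I_y$. $G$ is a chordal bigraph if it has no induced cycle of length greater than $4$. $G$ is a cocomparability bigraph if there exist linear orderings $\prec_X$ of $X$ and $\prec_Y$ of $Y$ such that for all $u,v\in X$, $w,z\in Y$ with $u\prec_X v$, $w\prec_Y z$ and $uz,vw\in E(G)$, at least one of $uw,vz$ is in $E(G)$. (Each of these notions does not depend on the chosen bipartition.) *)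

(* Defs.v *)
From mathcomp Require Import all_boot all_order all_algebra.
From mathcomp Require Import boolp classical_sets reals num_normedtype.

Set Implicit Arguments.
Unset Strict Implicit.
Unset Printing Implicit Defensive.

Section Bigraph.
Variables (T : finType) (e : rel T).

Definition simple_graph := symmetric e /\ irreflexive e.

(* Either part may be empty. *)
Definition bipartition (X Y : {set T}) :=
  [/\ Y = ~: X, {in X &, forall u v, ~~ e u v}
    & {in Y &, forall u v, ~~ e u v}].

(* The cycle visits [c] in order and closes up from its last vertex to its
   first; the only edges of the graph between vertices of [c] are those joining
   cyclically consecutive vertices. *)
Definition induced_cycle (c : seq T) :=
  [/\ 2 < size c, ucycle e c
    & {in c &, forall u v, e u v -> v = next c u \/ u = next c v}].

Definition chordal_bigraph :=
  forall c : seq T, induced_cycle c -> size c <= 4.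

Definition no_induced_C6 :=
  ~ exists c : seq T, induced_cycle c /\ size c = 6.

(* Intervals are arbitrary nonempty convex subsets of the real line: endpoints
   may be included or not, and intervals may be unbounded. *)
Definition interval_containment_bigraph (R : realType) (X Y : {set T}) :=
  exists I : T -> set R,
    (forall v, is_interval (I v) /\ (I v !=set0)%classic) /\
    {in X & Y, forall x y, e x y <-> (I y `<=` I x)%classic}.

Definition strict_linear_order_on (A : {set T}) (lt : rel T) :=
  [/\ {in A, irreflexive lt}, {in A & &, transitive lt}
    & {in A &, forall u v, u != v -> lt u v || lt v u}].

Definition cocomparability_bigraph (X Y : {set T}) :=
  exists ltX ltY : rel T,
    [/\ strict_linear_order_on X ltX, strict_linear_order_on Y ltY
      & {in X &, forall u v, {in Y &, forall w z,
          ltX u v -> ltY w z -> e u z -> e v w -> e u w || e v z}}].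

End Bigraph.

(* Main.v *)
(** Only the relative order of endpoints matters, so G is an interval
    containment bigraph iff its non-edges are covered by two Ferrers relations:
    "y sticks out of x on the left" and "y sticks out of x on the right".
    Conversely, in a cocomparability ordering every alternating 4-cycle (edges
    uw, vz, non-edges uz, vw) has its non-edges on the anti-diagonal, so one of
    them is the upper right and the other the lower left one. A non-edge playing
    both roles would yield an induced C6. Without C6, the non-edges that are
    never lower left, and those that are never upper right, therefore cover all
    non-edges; both relations turn out to be Ferrers. *)
Require Import Defs.
From mathcomp Require Import all_boot all_order all_algebra.
From mathcomp Require Import boolp classical_sets reals num_normedtype.
From mathcomp Require Import zify.

Set Implicit Arguments.
Unset Strict Implicit.
Unset Printing Implicit Defensive.

(** * Numberings of preorders and Ferrers relations *)

Lemma total_preorder_rank (T : finType) (le : rel T) :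
  total le -> transitive le ->
  exists f : T -> nat, forall u v, le u v = (f u <= f v).
Proof.
move=> le_total le_trans; have le_refl v : le v v by have := le_total v v; rewrite orbb.
exists (fun v => #|[set w | le w v]|) => u v; apply/idP/idP => [le_uv|].
  by apply: subset_leq_card; apply/fintype.subsetP => w; rewrite !inE => /le_trans; apply.
apply: contraTT => nle_uv; rewrite -ltnNge.
have le_vu : le v u by move: (le_total u v) nle_uv; case: (le u v).
apply: proper_card; apply/properP; split.
  by apply/fintype.subsetP => w; rewrite !inE => /le_trans; apply.
by exists u; rewrite !inE.
Qed.

(** Excluding alternating 4-cycles makes the rows of [A], as sets of columns, a chain under
    inclusion. *)
Definition ferrers (S T : Type) (A : S -> T -> bool) :=
  forall x x' y y', A x y -> A x' y' -> A x y' || A x' y.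

(** Nested rows are numbered by their size; a column [y] meets exactly the rows larger than the
    largest row missing [y]. *)
Lemma ferrers_rank (T : finType) (A : rel T) : ferrers A ->
  exists f g : T -> nat, forall x y, A x y = (g y < f x).
Proof.
move=> ferA; pose f x := #|[set y | A x y]|.
exists f, (fun y => \max_(x | ~~ A x y) f x) => x y.
apply/idP/idP => [Axy|]; last first.
  by apply: contraTT => nAxy; rewrite -leqNgt; apply: leq_bigmax_cond.
have fx_gt0 : 0 < f x by apply/card_gt0P; exists y; rewrite inE.
rewrite -(prednK fx_gt0) ltnS; apply/bigmax_leqP => x' nAx'y.
rewrite -ltnS prednK //; apply: proper_card; apply/properP; split.
  apply/fintype.subsetP => z; rewrite !inE => Ax'z.
  by have := ferA _ _ _ _ Axy Ax'z; rewrite (negPf nAx'y) orbF.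
by exists y; rewrite !inE.
Qed.

(** * Intervals versus ranks *)

Section Containment.
Variables (R : realType) (T : finType) (e : rel T) (X Y : {set T}).
Import Order.TTheory GRing.Theory Num.Theory.
Local Open Scope ring_scope.

(** Left ends are compared through points rather than infima, which covers open and unbounded
    intervals alike; the reverse order treats right ends. *)
Lemma reach_rank (le : rel R) (I : T -> set R) : total le -> transitive le ->
  exists f : T -> nat, forall u v,
    (f u <= f v)%N <-> forall t, I v t -> exists2 s, I u s & le s t.
Proof.
move=> le_total le_trans.
pose reach u v := `[< forall t, I v t -> exists2 s, I u s & le s t >].
have [|v u w /asboolP uv /asboolP vw|f fP] := @total_preorder_rank T reach.
- move=> u v; case: (boolP (reach u v)) => //= /asboolPn.
  move=> /existsNP[t /not_implyP[Ivt nIu]]; apply/asboolP => s Ius.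
  exists t => //; have /orP[//|le_st] := le_total t s.
  by case: nIu; exists s.
- apply/asboolP => t /vw[s /uv[s' ? le_s's] le_st].
  by exists s' => //; apply: le_trans le_st.
by exists f => u v; rewrite -fP; split=> /asboolP.
Qed.

(* [l] numbers the left endpoints from left to right and [r] the right
   endpoints from right to left. *)
Lemma interval_containment_rankP :
  interval_containment_bigraph e R X Y <->
  exists l r : T -> nat,
    {in X & Y, forall x y, e x y = (l x <= l y)%N && (r x <= r y)%N}.
Proof.
split=> [[I [I_itv eI]] | [l [r e_lr]]].
  have [l lP] := reach_rank I (@le_total _ R) (@le_trans _ R).
  have [r rP] := reach_rank I (@ge_total _ R) (@ge_trans _ R).
  exists l, r => x y xX yY; apply/idP/andP.
    move=> /(eI x y xX yY) sub_yx.
    by split; [apply/lP | apply/rP] => t /sub_yx ?; exists t => //=.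
  case=> /lP xL /rP xR; apply/(eI x y xX yY) => t Iyt.
  have [s Ixs le_st] := xL t Iyt; have [s' Ixs' le_ts'] := xR t Iyt.
  by have [+ _] := I_itv x; apply; [exact: Ixs | exact: Ixs' | rewrite le_st].
(* With [N] bounding all ranks, every interval [[l v - N, N - r v]] contains 0 and so is
   nonempty. *)
pose N := (\max_v maxn (l v) (r v))%N.
have le_lN v : (l v <= N)%N.
  exact: leq_trans (leq_maxl _ _) (leq_bigmax v).
have le_rN v : (r v <= N)%N.
  exact: leq_trans (leq_maxr _ _) (leq_bigmax v).
pose I v : set R := [set t | (l v)%:R - N%:R <= t <= N%:R - (r v)%:R]%classic.
exists I; split=> [v|x y xX yY].
  split=> [s t /andP[ls _] /andP[_ tr] u /andP[su ut] | ].
    by apply/andP; split; [apply: le_trans su | apply: le_trans tr].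
  by exists 0; rewrite /I /= subr_le0 subr_ge0 !ler_nat le_lN le_rN.
rewrite e_lr //; split=> [/andP[le_l le_r] t /andP[lt tr] | sub_yx].
  apply/andP; split.
    by apply: le_trans lt; rewrite lerB ?ler_nat.
  by apply: le_trans tr _; rewrite lerB ?ler_nat.
(* Testing the inclusion at the two endpoints of [I y] recovers both rank inequalities. *)
have le_lr : (l y)%:R - N%:R <= N%:R - (r y)%:R :> R.
  by apply: (@le_trans _ _ 0); rewrite ?subr_le0 ?subr_ge0 ler_nat.
have /sub_yx/andP[le_l _] : I y ((l y)%:R - N%:R) by rewrite /I /= lexx.
have /sub_yx/andP[_ le_r] : I y (N%:R - (r y)%:R) by rewrite /I /= le_lr lexx.
move: le_l le_r; rewrite lerD2r ler_nat lerD2l lerN2 ler_nat => -> ->.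
by [].
Qed.

End Containment.

(** * Ranked bigraphs are chordal and cocomparability *)

Section RankedBigraph.
Variables (T : finType) (e : rel T) (X Y : {set T}) (l r : T -> nat).
Hypothesis e_lr : {in X & Y, forall x y, e x y = (l x <= l y) && (r x <= r y)}.

(** Both parts are sorted by [l], ties broken by [enum_rank]. For edges [uz], [vw] this gives
    [l u <= l v <= l w <= l z]; if [uw] and [vz] both failed on the right, then
    [r w < r u <= r z < r v <= r w]. *)
Lemma ranked_cocomparability : cocomparability_bigraph e X Y.
Proof.
pose k v := l v * #|T| + enum_rank v.
have k_mono u v : l u < l v -> k u < k v.
  move=> lt_l; apply: (@leq_trans ((l u).+1 * #|T|)).
    by rewrite mulSn addnC /k -addnS leq_add2l; apply: ltn_ord.
  by apply: leq_trans (leq_addr _ _); rewrite leq_mul2r lt_l orbT.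
have k_inj : injective k.
  move=> u v eq_k; apply: enum_rank_inj; apply: val_inj => /=.
  have [lt_l | lt_l | eq_l] := ltngtP (l u) (l v).
  - by have := k_mono _ _ lt_l; lia.
  - by have := k_mono _ _ lt_l; lia.
  by move/eqP: eq_k; rewrite /k eq_l eqn_add2l => /eqP.
pose lt u v := k u < k v.
have lt_order (A : {set T}) : strict_linear_order_on A lt.
  split=> [v _|v u w _ _ _|u v _ _ neq_uv]; first exact: ltnn.
    exact: ltn_trans.
  by rewrite /lt -neq_ltn (inj_eq k_inj).
exists lt, lt; split=> // u v uX vX w z wY zY lt_uv lt_wz.
have le_l a b : lt a b -> l a <= l b.
  by rewrite leqNgt => lt_ab; apply/negP => /k_mono; rewrite /lt in lt_ab; lia.
move/le_l: lt_uv; move/le_l: lt_wz; rewrite !e_lr //; lia.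
Qed.

Hypotheses (simple_e : simple_graph e) (bip_XY : bipartition e X Y).

Lemma bipartition_edge u v : e u v -> (v \in Y) = (u \in X).
Proof.
case: bip_XY => Y_def X_ind Y_ind uv; rewrite Y_def inE.
case: (boolP (u \in X)) => uX; case: (boolP (v \in X)) => vX //=.
  by have := X_ind _ _ uX vX; rewrite uv.
by have := Y_ind u v; rewrite Y_def !inE uX vX uv => /(_ isT isT).
Qed.

Lemma iter_next_neq (c : seq T) v i :
  uniq c -> v \in c -> 0 < i < size c -> iter i (next c) v != v.
Proof.
move=> c_uniq vc /andP[i_gt0 i_lt]; apply/eqP => iter_v.
have ord_v := order_cycle (cycle_next c_uniq) c_uniq vc.
have := @findex_iter _ (next c) v i; rewrite ord_v iter_v findex0 => /(_ i_lt).
by lia.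
Qed.

(* The leftmost [y] of the cycle has neighbours [n b] and [n y], whose other
   neighbours are [b] and [a]; whichever of [a] and [b] extends less to the
   right yields a chord. *)
Lemma ranked_chordal : chordal_bigraph e.
Proof.
move=> c [_ /andP[c_cycle c_uniq] c_ind]; rewrite leqNgt; apply/negP => c_gt4.
have [e_sym _] := simple_e.
pose n := next c.
have n_c v : v \in c -> n v \in c by rewrite mem_next.
have e_n v : v \in c -> e v (n v) by apply: next_cycle.
have [v0 v0c] : exists v, v \in c.
  by case: (c) c_gt4 => // v s _; exists v; rewrite mem_head.
have [y0 y0P] : exists y, (y \in c) && (y \in Y).
  case: (boolP (v0 \in Y)) => v0Y; first by exists v0; rewrite v0c.
  exists (n v0); rewrite n_c // (bipartition_edge (e_n _ v0c)).
  by case: bip_XY v0Y => -> _ _; rewrite inE negbK.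
case: (@arg_minnP _ _ [pred y in c | y \in Y] l y0P) =>
  y /andP[yc yY] y_min {y0 y0P v0 v0c}.
pose b := prev c (prev c y).
have bc : b \in c by rewrite !mem_prev.
have y_def : y = n (n b) by rewrite /n /b !next_prev.
pose a := n (n y).
have e_nb : e (n b) y by rewrite [y]y_def; apply: e_n; apply: n_c.
have e_ny : e (n y) y by rewrite e_sym; apply: e_n.
have e_nb_b : e (n b) b by rewrite e_sym; apply: e_n.
have e_ny_a : e (n y) a by apply: e_n; apply: n_c.
have nbX : n b \in X by rewrite -(bipartition_edge e_nb).
have nyX : n y \in X by rewrite -(bipartition_edge e_ny).
have bY : b \in Y by rewrite (bipartition_edge e_nb_b).
have aY : a \in Y by rewrite (bipartition_edge e_ny_a).
have ac : a \in c by rewrite !n_c.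
have iter_neq v i : v \in c -> 0 < i < 5 -> iter i n v <> v.
  by move=> vc /andP[i_gt0 i_lt5]; apply/eqP/iter_next_neq; rewrite ?i_gt0 ?(leq_trans i_lt5).
(* An edge here would join cyclic neighbours, so some vertex would return to itself after two or
   four steps of [n], on a cycle of more than four vertices. *)
have ne_ba : ~~ e (n b) a.
  apply/negP => /(c_ind _ _ (n_c _ bc) ac) [] /=.
    by rewrite -/n -y_def; apply: (iter_neq y 2).
  rewrite /a [in n y]y_def => eq_nb.
  by apply: (iter_neq (n b) 4); rewrite ?n_c //= -eq_nb.
have ne_yb : ~~ e (n y) b.
  apply/negP => /(c_ind _ _ (n_c _ yc) bc) [] /=.
    by rewrite -/n y_def => eq_b; apply: (iter_neq b 4) => //=; rewrite -eq_b.
  by rewrite -/n [in n y]y_def; apply: (iter_neq (n b) 2); rewrite ?n_c.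
have le_ya : l y <= l a by apply: y_min; rewrite inE ac.
have le_yb : l y <= l b by apply: y_min; rewrite inE bc.
rewrite !e_lr // in e_nb e_ny e_nb_b e_ny_a ne_ba ne_yb.
have [[le_l_nb _] [le_l_ny _]] := (andP e_nb, andP e_ny).
have [[_ le_r_nb] [_ le_r_ny]] := (andP e_nb_b, andP e_ny_a).
(* The left conditions hold, so the two non-edges give [r a < r (n b) <= r b] and
   [r b < r (n y) <= r a]. *)
rewrite (leq_trans le_l_nb le_ya) -ltnNge in ne_ba.
rewrite (leq_trans le_l_ny le_yb) -ltnNge in ne_yb.
have := leq_trans (leq_trans ne_ba le_r_nb) (ltnW (leq_trans ne_yb le_r_ny)).
by rewrite ltnn.
Qed.

End RankedBigraph.

(** * Alternating 4-cycles and the two Ferrers relations *)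

Section Conflict.
Variables (T : finType) (E ltX ltY : rel T).

(* [(x, y)] is the upper right non-edge of an alternating 4-cycle, rows being
   ordered by [ltX] from top to bottom and columns by [ltY] from left to
   right. *)
Definition upper x y :=
  ~~ E x y && [exists v, exists w, [&& ltX x v, ltY w y, E x w, E v y & ~~ E v w]].

Lemma upperP x y : reflect
  (~~ E x y /\ exists v w, [/\ ltX x v, ltY w y, E x w, E v y & ~~ E v w])
  (upper x y).
Proof.
apply: (iffP andP) => -[nxy].
  by move=> /existsP[v /existsP[w /and5P[*]]]; split=> //; exists v, w.
by move=> [v [w /and5P vw]]; split=> //; apply/existsP; exists v; apply/existsP; exists w.
Qed.

End Conflict.

Section Decomposition.
Variables (T : finType) (E : rel T).

Definition diagonal (ltX ltY : rel T) := forall u v w z,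
  E u w -> E v z -> ~~ E u z -> ~~ E v w ->
  (ltX u v && ltY w z) || (ltX v u && ltY z w).

(** The edges form the 6-cycle [x1 y2 x3 y1 x2 y3], whose only possible chords are the [xi yi]. *)
Definition no_hexagon := forall x1 x2 x3 y1 y2 y3,
  E x1 y2 -> E x1 y3 -> E x2 y1 -> E x2 y3 -> E x3 y1 -> E x3 y2 ->
  [|| E x1 y1, E x2 y2 | E x3 y3].

Section Orders.
Variables ltX ltY : rel T.
Hypotheses (irrX : irreflexive ltX) (trX : transitive ltX).
Hypotheses (irrY : irreflexive ltY) (trY : transitive ltY).
Hypothesis diagE : diagonal ltX ltY.
Let gtX : rel T := fun u v => ltX v u.
Let gtY : rel T := fun u v => ltY v u.
Local Notation upp := (upper E ltX ltY).
Local Notation low := (upper E gtX gtY).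

(** For a non-edge [u z] in both roles, [diagonal] forces the edges [v' w] and [v w'] between the
    two witnessing 4-cycles; these complete a hexagon on the rows [v], [u], [v'] and the columns
    [w], [z], [w']. *)
Lemma upper_not_lower : no_hexagon -> forall x y, upp x y -> ~~ low x y.
Proof.
move=> nohex u z /upperP[nuz [v [w [uv wz uw vz nvw]]]].
apply/negP => /upperP[_ [v' [w' [v'u zw' uw' v'z nv'w']]]].
rewrite /gtX /gtY in v'u zw'.
have v'w : E v' w.
  apply: contraT => nv'w; case/orP: (diagE uw v'z nuz nv'w) => /andP[lt1 lt2].
    by have := trX lt1 v'u; rewrite irrX.
  by have := trY lt2 wz; rewrite irrY.
have vw' : E v w'.
  apply: contraT => nvw'; case/orP: (diagE uw' vz nuz nvw') => /andP[lt1 lt2].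
    by have := trY lt2 zw'; rewrite irrY.
  by have := trX lt1 uv; rewrite irrX.
have := nohex v u v' w z w' vz vw' uw uw' v'w v'z.
by rewrite (negPf nvw) (negPf nuz) (negPf nv'w').
Qed.

Lemma alternating_upper_lower u v w z :
  E u w -> E v z -> ~~ E u z -> ~~ E v w ->
  [/\ upp u z, low v w, ltX u v & ltY w z] \/ [/\ low u z, upp v w, ltX v u & ltY z w].
Proof.
move=> uw vz nuz nvw.
case/orP: (diagE uw vz nuz nvw) => /andP[lt1 lt2]; [left|right]; split=> //;
by apply/upperP; split=> //; do 2![eexists]; split; eassumption.
Qed.

(** One of the two Ferrers relations; reversing both orders exchanges [upp] and [low] and yields the
    other. *)
Let A x y := ~~ E x y && ~~ low x y.

Lemma not_lower_alternating u v w z : E u w -> E v z -> A u z -> ~ A v w.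
Proof.
move=> uw vz /andP[nuz nluz] /andP[nvw nlvw].
by case: (alternating_upper_lower uw vz nuz nvw) => -[h1 h2 _ _];
  rewrite ?h1 ?h2 in nluz nlvw.
Qed.

Hypothesis upp_low : forall x y, upp x y -> ~~ low x y.

(** The opposite corner of a 4-cycle witnessing [low x y] is upper right, hence not lower left. *)
Lemma lower_partner x y : low x y ->
  exists u z, [/\ ltX u x, E x z, E u y & A u z].
Proof.
move=> lxy; have /upperP[nxy [u [z [ltux _ xz uy nuz]]]] := lxy.
exists u, z; split=> //; rewrite /A nuz /=.
case: (alternating_upper_lower uy xz nuz nxy) => -[]; first by move/upp_low.
by move=> _ /upp_low; rewrite lxy.
Qed.

(* The non-edges of an offending 2x2 block generate an alternating 3x3 block,
   whose rows would be ordered cyclically by [ltX]. *)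
Lemma not_lower_square x x' y y' : A x y -> A x' y' -> E x y' -> ~~ low x' y.
Proof.
move=> Axy Ax'y' xy'; apply/negP => /lower_partner[u [z [lt_ux' x'z uy Auz]]].
(* An edge [x z], and likewise [u y'], would close an alternating 4-cycle with both non-edges in
   [A]. *)
have nxz : ~~ E x z.
  by apply/negP => xz; apply: (not_lower_alternating uy xz Auz Axy).
have nuy' : ~~ E u y'.
  by apply/negP => uy'; apply: (not_lower_alternating uy' x'z Auz Ax'y').
case/andP: Axy => nxy nlxy; case/andP: Ax'y' => nx'y' nlx'y'.
(* As [x' y'] and [x y] are not lower left, the orientations are forced: [x'] before [x] before [u],
   whereas [u] precedes [x']. *)
case: (alternating_upper_lower xy' x'z nxz nx'y') => -[h1 h2 lt_x'x _].
  by rewrite h2 in nlx'y'.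
case: (alternating_upper_lower uy xy' nuy' nxy) => -[h3 h4 lt_xu _].
  by rewrite h4 in nlxy.
by have := trX (trX lt_xu lt_ux') lt_x'x; rewrite irrX.
Qed.

(** In a counterexample, [x y'] and [x' y] are each an edge or lower left. Two edges contradict
    [not_lower_alternating], one edge contradicts [not_lower_square], and no edge reduces to the
    latter. *)
Lemma ferrers_not_lower : ferrers A.
Proof.
move=> x x' y y' Axy Ax'y'; apply: contraT.
have notA u v : ~~ A u v -> E u v \/ low u v.
  by rewrite /A; case: (E u v); case: (low u v); auto.
rewrite negb_or => /andP[/notA[xy'|lxy'] /notA[x'y|lx'y]].
- by case: (not_lower_alternating xy' x'y Axy Ax'y').
- by have := not_lower_square Axy Ax'y' xy'; rewrite lx'y.
- by have := not_lower_square Ax'y' Axy x'y; rewrite lxy'.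
(* Of the non-edges [x w] and [x' z], one is upper right, hence in [A]; its column replaces [y] or
   [y'] and brings in an edge. *)
have [u [z [_ xz uy' Auz]]] := lower_partner lxy'.
have [v [w [_ x'w vy Avw]]] := lower_partner lx'y.
have nx'z : ~~ E x' z.
  by apply/negP => x'z; apply: (not_lower_alternating uy' x'z Auz Ax'y').
have nxw : ~~ E x w.
  by apply/negP => xw; apply: (not_lower_alternating vy xw Avw Axy).
case: (alternating_upper_lower xz x'w nxw nx'z) => -[h1 h2 _ _].
  have Axw : A x w by rewrite /A nxw upp_low.
  by have := not_lower_square Ax'y' Axw x'w; rewrite lxy'.
have Ax'z : A x' z by rewrite /A nx'z upp_low.
by have := not_lower_square Axy Ax'z xz; rewrite lx'y.
Qed.

End Orders.

(** Each of the two Ferrers relations becomes a strict rank inequality; since they cover the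
    non-edges, edges are the pairs violating both. *)
Lemma diagonal_rank (ltX ltY : rel T) :
  irreflexive ltX -> transitive ltX -> irreflexive ltY -> transitive ltY ->
  diagonal ltX ltY -> no_hexagon ->
  exists lX lY rX rY : T -> nat,
    forall x y, E x y = (lX x <= lY y) && (rX x <= rY y).
Proof.
move=> irrX trX irrY trY diagE nohex.
pose gtX : rel T := fun u v => ltX v u; pose gtY : rel T := fun u v => ltY v u.
have tr_gtX : transitive gtX by move=> v u w uv vw; apply: trX vw uv.
have diagE' : diagonal gtX gtY.
  by move=> u v w z uw vz nuz nvw; rewrite orbC; apply: diagE.
have upp_low := upper_not_lower irrX trX irrY trY diagE nohex.
have low_upp x y : upper E gtX gtY x y -> ~~ upper E ltX ltY x y.
  by apply: contraL; apply: upp_low.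
have [lX [lY lP]] := ferrers_rank (ferrers_not_lower irrX trX diagE upp_low).
have [rX [rY rP]] :=
  ferrers_rank (@ferrers_not_lower gtX gtY irrX tr_gtX diagE' low_upp).
exists lX, lY, rX, rY => x y; rewrite [lX x <= _]leqNgt [rX x <= _]leqNgt -lP -rP.
case: (boolP (E x y)) => //= nxy; rewrite !negbK.
by apply/esym/andP => -[/low_upp/negP].
Qed.

End Decomposition.

(** * From the symmetric graph to rows and columns *)

Section Sufficiency.
Variables (T : finType) (e : rel T) (X Y : {set T}).
Hypotheses (simple_e : simple_graph e) (bip_XY : bipartition e X Y).

Let E : rel T := fun x y => [&& x \in X, y \in Y & e x y].

(** The six vertices are distinct: two in the same part are separated by a vertex adjacent to
    exactly one of them. *)
Lemma no_induced_C6_no_hexagon : no_induced_C6 e -> no_hexagon E.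
Proof.
have [e_sym _] := simple_e; have [Y_def X_ind Y_ind] := bip_XY.
have E_e x y : E x y -> e x y by case/and3P.
have nE_e x y : x \in X -> y \in Y -> ~~ E x y -> (e x y = false) * (e y x = false).
  by move=> xX yY; rewrite /E xX yY /= => /negPf nxy; rewrite (e_sym y) nxy.
have XX u v : u \in X -> v \in X -> e u v = false.
  by move=> uX vX; apply/negbTE/X_ind.
have YY u v : u \in Y -> v \in Y -> e u v = false.
  by move=> uY vY; apply/negbTE/Y_ind.
have XY_neq u v : u \in X -> v \in Y -> (u == v = false) * (v == u = false).
  move=> uX; rewrite Y_def inE => nvX; rewrite [v == u]eq_sym.
  by case: eqP nvX => // <-; rewrite uX.
have neqX x x' y : E x y -> ~~ E x' y -> (x == x' = false) * (x' == x = false).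
  by move=> xy nx'y; rewrite [x' == x]eq_sym; case: eqP nx'y => // <-; rewrite xy.
have neqY x y y' : E x y -> ~~ E x y' -> (y == y' = false) * (y' == y = false).
  by move=> xy nxy'; rewrite [y' == y]eq_sym; case: eqP nxy' => // <-; rewrite xy.
move=> noC6 x1 x2 x3 y1 y2 y3 e12 e13 e21 e23 e31 e32.
apply: contraT; rewrite !negb_or => /and3P[n11 n22 n33]; case: noC6.
have [/and3P[x1X y2Y _] /and3P[x2X y3Y _] /and3P[x3X y1Y _]] := And3 e12 e23 e31.
pose eqs := (eqxx, neqX _ _ _ e12 n22, neqX _ _ _ e13 n33, neqX _ _ _ e23 n33,
  neqY _ _ _ e12 n11, neqY _ _ _ e13 n11, neqY _ _ _ e23 n22,
  (XY_neq _ _ x1X y1Y, XY_neq _ _ x1X y2Y, XY_neq _ _ x1X y3Y),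
  (XY_neq _ _ x2X y1Y, XY_neq _ _ x2X y2Y, XY_neq _ _ x2X y3Y),
  (XY_neq _ _ x3X y1Y, XY_neq _ _ x3X y2Y, XY_neq _ _ x3X y3Y)).
exists [:: x1; y2; x3; y1; x2; y3]; split=> //; split=> //.
  apply/andP; split; last by rewrite /= !inE !eqs.
  by rewrite /= (e_sym y2) (e_sym y1) (e_sym y3) !E_e.
have nes := (nE_e _ _ x1X y1Y n11, nE_e _ _ x2X y2Y n22,
  nE_e _ _ x3X y3Y n33).
move=> u v; rewrite !inE => uc vc.
do 5?[case/orP: uc => uc]; rewrite (eqP uc) {u uc};
  do 5?[case/orP: vc => vc]; rewrite (eqP vc) {v vc};
  rewrite ?nes // => uv; first
    [by rewrite XX in uv | by rewrite YY in uv
    | by rewrite /next /= !eqs; left | by rewrite /next /= !eqs; right].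
Qed.

Lemma cocomparability_rank : no_induced_C6 e -> cocomparability_bigraph e X Y ->
  exists l r : T -> nat,
    {in X & Y, forall x y, e x y = (l x <= l y) && (r x <= r y)}.
Proof.
move=> noC6 [ltX [ltY [[irrX trX totX] [irrY trY totY] coco]]].
have [Y_def _ _] := bip_XY.
(* Restricting to the parts makes irreflexivity and transitivity hold on the whole type. *)
pose ltX' : rel T := fun u v => [&& u \in X, v \in X & ltX u v].
pose ltY' : rel T := fun u v => [&& u \in Y, v \in Y & ltY u v].
have [||||u v w z||lX [lY [rX [rY lrP]]]] := @diagonal_rank T E ltX' ltY'.
- by move=> v; apply/negP => /and3P[vX _]; rewrite irrX.
- move=> v u w /and3P[uX vX uv] /and3P[_ wX vw].
  by apply/and3P; split=> //; apply: trX uv vw.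
- by move=> v; apply/negP => /and3P[vX _]; rewrite irrY.
- move=> v u w /and3P[uX vX uv] /and3P[_ wX vw].
  by apply/and3P; split=> //; apply: trY uv vw.
- case/and3P=> uX wY uw /and3P[vX zY vz].
  rewrite /E /ltX' /ltY' uX vX wY zY /= => nuz nvw.
  have neq_uv : u != v by apply: contraNneq nvw => <-.
  have neq_wz : w != z by apply: contraNneq nuz => <-.
  (* The two instances exclude the cases where [ltX] and [ltY] order the edges [uw] and [vz]
     oppositely. *)
  have := coco u v uX vX z w zY wY; have := coco v u vX uX w z wY zY.
  rewrite uw vz (negPf nuz) (negPf nvw) /=.
  case: (boolP (ltX u v)) (totX u v uX vX neq_uv) => [uv _|nuv /= ->];
    case: (boolP (ltY w z)) (totY w z wY zY neq_wz) => [wz _|nwz /= ->] //=.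
  + by move=> _ /(_ isT isT isT isT).
  + by move=> /(_ isT isT isT isT).
- exact: no_induced_C6_no_hexagon.
exists (fun v => if v \in X then lX v else lY v).
exists (fun v => if v \in X then rX v else rY v) => x y xX yY.
have nyX : (y \in X) = false by move: yY; rewrite Y_def inE => /negPf.
by rewrite nyX xX -lrP /E xX yY.
Qed.

End Sufficiency.

Theorem theorem4p5 (R : realType) (T : finType) (e : rel T) (X Y : {set T})
    (simple_e : simple_graph e) (bip_XY : bipartition e X Y) :
  [<-> interval_containment_bigraph e R X Y;
       chordal_bigraph e /\ cocomparability_bigraph e X Y;
       no_induced_C6 e /\ cocomparability_bigraph e X Y].
Proof.
tfae.
- move=> /interval_containment_rankP[l [r e_lr]]; split.
    exact: ranked_chordal e_lr simple_e bip_XY.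
  exact: ranked_cocomparability e_lr.
- by case=> chordal_e coco; split=> // -[c [/chordal_e + c_size]]; rewrite c_size.
case=> noC6 coco; apply/interval_containment_rankP.
exact: cocomparability_rank.
Qed.
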